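(* Let $\Omega\subset\mathbb{R}^n$ be a bounded domain and $\varepsilon>0$. Let $u:\Omega_\varepsilon\to\mathbb{R}$ be a bounded Borel function, and let $\delta>0$. Then there are bounded Borel functions $S_{\sup},S_{\inf}:\Omega\to\Omega_\varepsilon$ such that $S_{\inf}(x),S_{\sup}(x)\in B_\varepsilon(x)$, $$u(S_{\sup}(x))\ge\sup_{B_\varepsilon(x)}u-\delta\qquad\text{and}\qquad u(S_{\inf}(x))\le\inf_{B_\varepsilon(x)}u+\delta$$ for all $x\in\Omega$.
   Context: $B_\varepsilon(x)$ denotes the open ball of radius $\varepsilon$ centred at $x$. $\Gamma_\varepsilon=\{x\in\mathbb{R}^n\setminus\Omega:\operatorname{dist}(x,\Omega)\le\varepsilon\}$ and $\Omega_\varepsilon=\Gamma_\varepsilon\cup\Omega$. *)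

(* Defs.v *)
From HB Require Import structures.
From mathcomp Require Import all_boot all_order all_algebra.
From mathcomp Require Import all_classical all_reals all_analysis.
Import Order.TTheory GRing.Theory Num.Theory.
Import numFieldNormedType.Exports.

Set Implicit Arguments.
Unset Strict Implicit.
Unset Printing Implicit Defensive.

Local Open Scope classical_set_scope.
Local Open Scope ring_scope.

(* The library norm and balls on 'rV[R]_n are those of the sup norm, so the
   Euclidean ones are defined here; the library topology and bounded sets on
   'rV[R]_n are the usual ones of R^n, all norms being equivalent. *)
Definition enorm (R : realType) (n : nat) (x : 'rV[R]_n) : R :=
  Num.sqrt (\sum_(i < n) x 0 i ^+ 2).

Definition eball (R : realType) (n : nat) (x : 'rV[R]_n) (e : R)
    : set 'rV[R]_n :=
  [set y | enorm (y - x) < e].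

Definition edist (R : realType) (n : nat) (x : 'rV[R]_n) (A : set 'rV[R]_n)
    : R :=
  inf [set enorm (x - y) | y in A].

Definition domain (R : realType) (n : nat) (Omega : set 'rV[R]_n) : Prop :=
  [/\ open Omega, connected Omega & Omega !=set0].

Definition boundary_strip (R : realType) (n : nat) (Omega : set 'rV[R]_n)
    (eps : R) : set 'rV[R]_n :=
  [set x | ~ Omega x /\ edist x Omega <= eps].

Definition enlarged (R : realType) (n : nat) (Omega : set 'rV[R]_n) (eps : R)
    : set 'rV[R]_n :=
  boundary_strip Omega eps `|` Omega.

Definition borel_rV (R : realType) (n : nat) :=
  g_sigma_algebraType (@open 'rV[R]_n).

(* A function on D is represented by a total function whose values outside D
   are irrelevant. measurable_fun D is vacuous when D is not measurable; the
   domains it is meant for (an open set and its closed enlargement) are Borel. *)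
Definition bounded_borel_fun (R : realType) (n : nat) (D : set 'rV[R]_n)
    (f : 'rV[R]_n -> R) : Prop :=
  [bounded f x | x in D] /\
  measurable_fun (D : set (borel_rV R n)) (f : borel_rV R n -> R).

Definition bounded_borel_map (R : realType) (n : nat) (D : set 'rV[R]_n)
    (f : 'rV[R]_n -> 'rV[R]_n) : Prop :=
  [bounded f x | x in D] /\
  measurable_fun (D : set (borel_rV R n)) (f : borel_rV R n -> borel_rV R n).

(* Main.v *)
Require Import Defs.
From mathcomp Require Import all_boot all_order all_algebra.
From mathcomp Require Import all_classical all_reals all_analysis.
Import Order.TTheory GRing.Theory Num.Theory.
Import numFieldNormedType.Exports.

Local Open Scope classical_set_scope.
Local Open Scope ring_scope.

(** Two observations carry the proof. First, almost maximal values of [u] over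
    all balls are found on one fixed countable set: as the graph of [u], a
    subset of a second countable space, is separable, there is a sequence [a]
    such that any open set which contains a point with [u > c] contains some
    [a j] with [u (a j) > c] ([countable_dense_superlevel]). Applied to the ball
    about [x], with [c = sup u - delta], it provides an [a j] that is an
    admissible value for the selection at [x]: it lies in the ball, and
    [sup u <= u (a j) + delta] there.

    Second, the set of [x] for which [a j] is admissible is Borel. By symmetry
    of the distance, the ball about [x] contains [a j] exactly when [x] lies in
    the ball about [a j]; and [sup u <= u (a j) + delta] on the ball about [x]
    fails exactly when [x] lies in the union of the balls about the points [y]
    with [u y > u (a j) + delta]. So this set is the difference of two open
    sets.

    Countably many Borel sets thus cover [Omega], and choosing the first
    admissible [a j] is a Borel map with countably many values
    ([measurable_countable_selection]). The almost minimizing selection is the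
    almost maximizing one for [- u]. *)

Set Implicit Arguments.
Unset Strict Implicit.
Unset Printing Implicit Defensive.

(** Several [E j] may contain [x]: taking the first one splits [D] into
    countably many measurable pieces, on each of which the selection is
    constant. *)
Lemma measurable_countable_selection (d d' : measure_display)
    (T : measurableType d) (T' : measurableType d') (D : set T)
    (E : nat -> set T) (a : nat -> T') :
  measurable D -> (forall j, measurable (E j)) -> D `<=` \bigcup_j E j ->
  exists2 S : T -> T', measurable_fun D S &
    forall x, D x -> exists2 j, E j x & S x = a j.
Proof.
move=> mD mE DE; pose F := seqDU E.
pose first x := xget 0%N [set j | F j x].
have Ffirst x : D x -> F (first x) x.
  move=> /DE; rewrite seqDU_bigcup_eq => -[j _ Fjx].
  by rewrite /first; apply: (@xgetPex _ _ [set j | F j x]); exists j.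
exists (a \o first) => [_ Y mY|x Dx]; last first.
  by exists (first x) => //; apply: subset_seqDU; exact: Ffirst.
have -> : D `&` (a \o first) @^-1` Y =
    \bigcup_(j in [set j | Y (a j)]) (D `&` F j).
  apply/seteqP; split=> [x [Dx Yx]|x [j Yaj [Dx Fjx]]].
    by exists (first x) => //; split=> //; exact: Ffirst.
  have jE : first x = j.
    apply: (@trivIset_seqDU _ E _ _ Logic.I Logic.I).
    by exists x; split=> //; exact: Ffirst.
  by split=> //=; rewrite jE.
apply: bigcup_measurable => j _; apply: measurableI => //.
by apply: measurableD => //; apply: bigsetU_measurable => k _.
Qed.

Lemma rat_ball_approx (R : realType) (n : nat) (y : 'rV[R]_n) (r : R) :
  0 < r -> exists q : 'rV[rat]_n, ball y r (map_mx ratr q : 'rV[R]_n).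
Proof.
move=> r0.
have /choice[q qP] (j : 'I_n) : exists q : rat, y 0 j - r < ratr q < y 0 j + r.
  have lt_y : y 0 j - r < y 0 j + r by rewrite ltrD2l gtrN.
  by have [q] := rat_in_itvoo lt_y; rewrite in_itv /= => ?; exists q.
exists (\row_j q j); split=> // i j; rewrite ord1 !mxE /ball /= ltr_distlC.
by have /andP[-> ->] := qP j.
Qed.

(** Separability of the graph of [u], in the form used for selections. The sets
    of the points of a ball at which [u] exceeds a given level, with rational
    centre, radius and level, are countably many; [a] chooses a point in each
    nonempty one. *)
Lemma countable_dense_superlevel (R : realType) (n : nat) (u : 'rV[R]_n -> R) :
  exists a : nat -> 'rV[R]_n, forall (U : set 'rV[R]_n) y c,
    open U -> U y -> c < u y -> exists2 j, U (a j) & c < u (a j).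
Proof.
pose P (i : 'rV[rat]_n * (rat * rat)) : set 'rV[R]_n :=
  [set z | ball (map_mx ratr i.1 : 'rV[R]_n) (ratr i.2.1) z /\
           ratr i.2.2 < u z].
(* Both fallbacks, [0] for the numbers [j] that code no triple and for the
   triples whose set is empty, are harmless: [j] is chosen below so that
   neither occurs. *)
exists (fun j => if unpickle j is Some i then xget 0 (P i) else 0).
move=> U y c oU Uy cu.
have /nbhs_ballP[e /= e0 eU] : nbhs y U by exact: open_nbhs_nbhs.
have e20 : 0 < e / 2 by rewrite divr_gt0.
have [r] := rat_in_itvoo e20; rewrite in_itv /= => /andP[r0 re].
have [q yq] := rat_ball_approx y r0.
have [s] := rat_in_itvoo cu; rewrite in_itv /= => /andP[cs su].
have Py : P (q, (r, s)) y by split=> //=; exact: ball_sym.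
exists (pickle (q, (r, s))); rewrite pickleK.
all: have [/= qz sz] : P (q, (r, s)) (xget 0 (P (q, (r, s)))) by
  apply: xgetPex; exists y.
  apply: eU; apply: (@le_ball _ _ y (ratr r + ratr r)).
    by rewrite [leRHS]splitr lerD// ltW.
  exact: ball_triangle yq qz.
exact: lt_trans cs sz.
Qed.

Lemma enorm0 (R : realType) (n : nat) : enorm (0 : 'rV[R]_n) = 0.
Proof.
by rewrite /enorm big1 ?sqrtr0// => i _; rewrite mxE expr0n.
Qed.

Lemma enormN (R : realType) (n : nat) (x : 'rV[R]_n) : enorm (- x) = enorm x.
Proof.
by rewrite /enorm; congr Num.sqrt; apply: eq_bigr => i _; rewrite mxE sqrrN.
Qed.

Lemma eball_sym (R : realType) (n : nat) (x y : 'rV[R]_n) (e : R) :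
  eball x e y -> eball y e x.
Proof. by rewrite /eball /= -enormN opprB. Qed.

Lemma eball_center (R : realType) (n : nat) (x : 'rV[R]_n) (e : R) :
  0 < e -> eball x e x.
Proof. by move=> e0; rewrite /eball /= subrr enorm0. Qed.

(** Relates the Euclidean balls to the sup norm, in which boundedness is
    expressed. *)
Lemma mx_norm_le_enorm (R : realType) (n : nat) (x : 'rV[R]_n) :
  `|x| <= enorm x.
Proof.
rewrite [leLHS]mx_normrE; apply: bigmax_le => [|[i j] _ /=].
  exact: sqrtr_ge0.
rewrite -sqrtr_sqr ler_wsqrtr// ord1 (bigD1 j)//= lerDl sumr_ge0// => k _.
exact: sqr_ge0.
Qed.

Lemma continuous_enorm (R : realType) (n : nat) :
  continuous (@enorm R n).
Proof.
move=> x; rewrite /enorm; apply: continuous_comp; last exact: sqrt_continuous.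
apply: continuous_big => [|i _ {}x]; first exact: add_continuous.
apply: (@continuous_comp _ _ _ (fun y : 'rV[R]_n => y 0 i) (fun r => r ^+ 2)).
  exact: coord_continuous.
exact: exprn_continuous.
Qed.

Lemma open_eball (R : realType) (n : nat) (x : 'rV[R]_n) (e : R) :
  open (eball x e).
Proof.
have -> : eball x e = (fun y => enorm (y - x)) @^-1` [set r | r < e] by [].
apply: open_comp => [y _|]; last exact: open_lt.
apply: continuous_comp; last apply: continuous_enorm.
by apply: (@cvgB _ _ _ (nbhs y) _ id (cst x)); [apply: cvg_id|apply: cvg_cst].
Qed.

(** This is what makes bounds on the enlarged set control suprema over balls
    centred in [Omega]. *)
Lemma eball_sub_enlarged (R : realType) (n : nat) (Omega : set 'rV[R]_n)
    (eps : R) (x : 'rV[R]_n) :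
  Omega x -> eball x eps `<=` enlarged Omega eps.
Proof.
move=> Ox y xy; have [Oy|nOy] := pselect (Omega y); [by right|left].
split=> //; apply: le_trans (ltW xy); apply: ge_inf; last by exists x.
by exists 0 => _ [z _ <-]; exact: sqrtr_ge0.
Qed.

Lemma open_borel_rV (R : realType) (n : nat) (U : set 'rV[R]_n) :
  open U -> measurable (U : set (borel_rV R n)).
Proof. exact: sub_sigma_algebra. Qed.

Lemma bounded_of_norm_le (R : realType) (n : nat) (D : set 'rV[R]_n)
    (V : normedModType R) (f : 'rV[R]_n -> V) (M : R) :
  (forall x, D x -> `|f x| <= M) -> [bounded f x | x in D].
Proof.
move=> fM; exists M; split; first exact: num_real.
by move=> N /ltW MN x Dx; apply: le_trans MN; exact: fM.
Qed.

Lemma bounded_of_eball (R : realType) (n : nat) (Omega : set 'rV[R]_n)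
    (eps : R) (S : 'rV[R]_n -> 'rV[R]_n) :
  bounded_set Omega -> (forall x, Omega x -> eball x eps (S x)) ->
  [bounded S x | x in Omega].
Proof.
move=> /ex_strict_bound_gt0[M _ OM] SB.
apply: (@bounded_of_norm_le _ _ _ _ _ (M + eps)) => x Ox.
rewrite -[S x](subrK x) addrC (le_trans (ler_normD _ _))// lerD//.
  exact: ltW (OM _ Ox).
exact: le_trans (mx_norm_le_enorm _) (ltW (SB x Ox)).
Qed.

Lemma borel_sup_selection (R : realType) (n : nat) (Omega : set 'rV[R]_n)
    (eps : R) (u : 'rV[R]_n -> R) (delta : R) :
  open Omega -> bounded_set Omega -> 0 < eps ->
  [bounded u x | x in enlarged Omega eps] -> 0 < delta ->
  exists2 S : 'rV[R]_n -> 'rV[R]_n, bounded_borel_map Omega S &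
    forall x, Omega x -> eball x eps (S x) /\
      u (S x) >= sup [set u y | y in eball x eps] - delta.
Proof.
move=> oO bO eps0 /ex_strict_bound_gt0[M _ uM] delta0.
have [a aP] := countable_dense_superlevel u.
(* [V j] consists of the points whose ball carries a value of [u] above
   [u (a j) + delta], so [E j] is the set where [a j] is admissible. *)
pose V j := \bigcup_(y in [set y | u (a j) + delta < u y]) eball y eps.
pose E j := eball (a j) eps `\` V j.
have mE j : measurable (E j : set (borel_rV R n)).
  apply: measurableD; apply: open_borel_rV; first exact: open_eball.
  by apply: bigcup_open => y _; exact: open_eball.
have hs x : Omega x -> has_sup [set u y | y in eball x eps].
  move=> Ox; split; first by exists (u x), x => //; exact: eball_center.
  exists M => _ [y xy <-]; apply: le_trans (ler_norm _) _.
  exact/ltW/uM/(eball_sub_enlarged Ox).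
have OE : Omega `<=` \bigcup_j E j.
  move=> x Ox; have [_ [y xy <-] ysup] := sup_adherent delta0 (hs x Ox).
  have [j xj jsup] := aP _ _ _ (@open_eball _ _ x eps) xy ysup.
  exists j => //; split; first exact: eball_sym.
  case=> z /= + /eball_sym xz; apply/negP; rewrite -leNgt.
  rewrite -lerBlDr (le_trans _ (ltW jsup))// lerD2r.
  by apply: ub_le_sup; [exact: (hs x Ox).2|exists z].
have [S mS SE] := @measurable_countable_selection _ _
  (borel_rV R n) (borel_rV R n) Omega E a (open_borel_rV oO) mE OE.
have SP x : Omega x -> eball x eps (S x) /\
    u (S x) >= sup [set u y | y in eball x eps] - delta.
  move=> Ox; have [j [/eball_sym xj nVj] ->] := SE x Ox; split=> //.
  rewrite lerBlDr; apply: ge_sup; first exact: (hs x Ox).1.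
  move=> _ [y xy <-]; rewrite leNgt; apply/negP => lt_y; apply: nVj.
  by exists y => //; exact: eball_sym.
exists S => //; split=> //; apply: bounded_of_eball bO _ => x Ox.
exact: (SP x Ox).1.
Qed.

Unset Implicit Arguments.

Theorem lemma3p1 (R : realType) (n : nat) (Omega : set 'rV[R]_n) (eps : R)
    (u : 'rV[R]_n -> R) (delta : R) :
  domain Omega -> bounded_set Omega -> 0 < eps ->
  bounded_borel_fun (enlarged Omega eps) u -> 0 < delta ->
  exists Ssup Sinf : 'rV[R]_n -> 'rV[R]_n,
    [/\ bounded_borel_map Omega Ssup,
        bounded_borel_map Omega Sinf &
        forall x, Omega x ->
          [/\ enlarged Omega eps (Ssup x) /\ enlarged Omega eps (Sinf x),
              eball x eps (Sinf x) /\ eball x eps (Ssup x),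
              u (Ssup x) >= sup [set u y | y in eball x eps] - delta &
              u (Sinf x) <= inf [set u y | y in eball x eps] + delta]].
Proof.
move=> [oO _ _] bO eps0 [bu _] delta0.
have bNu : [bounded - u x | x in enlarged Omega eps].
  have [M _ uM] := ex_strict_bound_gt0 bu.
  apply: (@bounded_of_norm_le _ _ _ R^o _ M) => x /uM.
  by rewrite normrN => /ltW.
have [Ssup bSsup SsupP] := borel_sup_selection oO bO eps0 bu delta0.
have [Sinf bSinf SinfP] := borel_sup_selection oO bO eps0 bNu delta0.
exists Ssup, Sinf; split=> // x Ox.
have [xsup usup] := SsupP x Ox; have [xinf uinf] := SinfP x Ox.
split=> //; first by split; exact: (eball_sub_enlarged Ox).
(* The infimum of a set is by definition the opposite of the supremum of the
   opposite set, so this is the estimate for [- u] read backwards. *)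
by rewrite /inf image_comp -lerN2 opprD opprK.
Qed.
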